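(* If a free boundary $s_{4h}$ and a temperature $T_{4h}$ constitute a solution to problem $(\mathrm{P}_{4h})$, then they are given by $$T_{4h}(x,t)=t^{\alpha/2}\theta_\infty\left[A_{4h}\left(1-\frac{x}{s_{4h}(t)}\right)+B_{4h}\left(1-\frac{x}{s_{4h}(t)}\right)^2\right],\qquad s_{4h}(t)=2a\nu_{4h}\sqrt{t},$$ where the constants $A_{4h}$ and $B_{4h}$ are defined as functions of $\nu_{4h}$ by $$A_{4h}=\frac{2^{\alpha+1}\nu_{4h}^{\alpha+2}}{\mathrm{Ste}},\qquad B_{4h}=\frac{2\,\mathrm{Bi}\,\nu_{4h}-A_{4h}(1+2\,\mathrm{Bi}\,\nu_{4h})}{2(1+\mathrm{Bi}\,\nu_{4h})},$$ and where $\nu_{4h}>0$ must minimize over $\xi>0$, for every $t>0$, the real function $$\begin{aligned}E_h(\xi)=\;&\frac{t^{\alpha-2}\theta_\infty^2}{60\,\mathrm{Ste}^2\,\xi^2\left(\frac{1}{\mathrm{Bi}}+\xi\right)^2}\Big\{p(\xi)+\frac{1}{\mathrm{Bi}}\Big[2^{2\alpha}(7\alpha^2+7\alpha+18)\xi^{2\alpha+7}+25\cdot 2^{2\alpha+1}(\alpha+1)\xi^{2\alpha+5}\\&+2^{\alpha}(9\alpha^2+9\alpha+6)\mathrm{Ste}\,\xi^{\alpha+5}+15\cdot 2^{2\alpha+2}\xi^{2\alpha+3}-5\cdot 2^{\alpha+1}(\alpha+1)\mathrm{Ste}\,\xi^{\alpha+3}-15\cdot 2^{\alpha+1}\mathrm{Ste}\,\xi^{\alpha+1}\Big]\\&+\frac{1}{\mathrm{Bi}^2}\Big[4^{\alpha+1}(2\alpha^2+2\alpha+3)\xi^{2\alpha+6}+5\cdot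 4^{\alpha+1}(\alpha+1)\xi^{2\alpha+4}+15\cdot 4^{\alpha}\xi^{2\alpha+2}\Big]\Big\},\end{aligned}$$ with $$\begin{aligned}p(\xi)=\;&2^{2\alpha+1}(\alpha^2+\alpha+4)\xi^{2\alpha+8}+5\cdot 2^{2\alpha+2}(1+\alpha)\xi^{2\alpha+6}+15\cdot 2^{2\alpha+2}\xi^{2\alpha+4}\\&+2^{\alpha}\mathrm{Ste}(2+3\alpha+3\alpha^2)\xi^{\alpha+6}+5\cdot 2^{\alpha+1}\mathrm{Ste}(1+\alpha)\xi^{\alpha+4}-15\cdot 2^{\alpha+2}\mathrm{Ste}\,\xi^{\alpha+2}\\&+\mathrm{Ste}^2(2+3\alpha+3\alpha^2)\xi^4-10\,\mathrm{Ste}^2(1+\alpha)\xi^2+15\,\mathrm{Ste}^2.\end{aligned}$$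
   Context: Fix real parameters $k,\rho,c,\gamma,\theta_\infty,h>0$ and $\alpha\ge 0$; put $a=\sqrt{k/(\rho c)}$, and define the generalized Stefan number $\mathrm{Ste}=\dfrac{k\theta_\infty}{\gamma a^{\alpha+2}}$ and the Biot number $\mathrm{Bi}=\dfrac{ah}{k}$. A candidate pair $(T,s)$ consists of a continuous function $s:[0,\infty)\to[0,\infty)$, positive and continuously differentiable on $(0,\infty)$, and a function with quadratic profile in space $$T(x,t)=t^{\alpha/2}\theta_\infty\left[A\left(1-\frac{x}{s(t)}\right)+B\left(1-\frac{x}{s(t)}\right)^2\right],\quad 0\le x\le s(t),\ t>0,$$ with real constants $A,B$. The least-squares error of a candidate pair at time $t>0$ is $$\begin{aligned}E=\;&\tfrac{\alpha^2}{4}\theta_\infty^2t^{\alpha-2}\left(\tfrac{A^2}{3}+\tfrac{AB}{2}+\tfrac{B^2}{5}\right)+t^{\alpha}\theta_\infty^2\tfrac{\dot s(t)^2}{s(t)^2}\left(\tfrac{A^2}{3}+\tfrac{AB}{3}+\tfrac{2B^2}{15}\right)+4t^{\alpha}a^4\theta_\infty^2\tfrac{B^2}{s(t)^4}\\&+\alpha\theta_\infty^2t^{\alpha-1}\tfrac{\dot s(t)}{s(t)}\left(\tfrac{A^2}{6}+\tfrac{AB}{4}+\tfrac{B^2}{10}\right)-2\alpha a^2\theta_\infty^2t^{\alpha-1}\tfrac{B}{s(t)^2}\left(\tfrac A2+\tfrac B3\right)-4a^2\theta_\infty^2t^{\alpha}\tfrac{\dot s(t)}{s(t)^3}B\left(\tfrac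 A2+\tfrac B3\right),\end{aligned}$$ which equals $\dfrac{1}{s(t)}\displaystyle\int_0^{s(t)}\left(\frac{\partial T}{\partial t}-a^2\frac{\partial^2T}{\partial x^2}\right)^2dx$. Problem $(\mathrm{P}_{4h})$: among all candidate pairs satisfying, for all $t>0$, (i) $k\frac{\partial T}{\partial x}(0,t)=\frac{h}{\sqrt t}\left[T(0,t)-\theta_\infty t^{\alpha/2}\right]$, (ii) $T(s(t),t)=0$, (iii) $k\frac{\partial T}{\partial x}(s(t),t)=-\gamma s(t)^{\alpha}\dot s(t)$, and (iv) $s(0)=0$, find a pair $(T_{4h},s_{4h})$ that minimizes the error $E$ for every $t>0$. *)

(* Defs.v *)
From Stdlib Require Import Reals.
From Coquelicot Require Import Coquelicot.
Open Scope R_scope.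

(* Real exponent; [Rpower] is only meaningful for a positive base, and every
   base below is positive wherever the value matters. *)
Notation "x ^R y" := (Rpower x y) (at level 30, right associativity) : R_scope.

Definition sqrt_diffusivity (k rho c : R) : R := sqrt (k / (rho * c)).

Definition stefan_number (k gamma theta alpha a : R) : R :=
  k * theta / (gamma * a ^R (alpha + 2)).

Definition biot_number (k h a : R) : R := a * h / k.

Definition profile (alpha theta A B : R) (s : R -> R) (x t : R) : R :=
  t ^R (alpha / 2) * theta * (A * (1 - x / s t) + B * (1 - x / s t) ^ 2).

(* Functions on [0, oo) and on { 0 <= x <= s t, t > 0 } are represented by total
   functions, constrained only on those sets. *)
Definition free_boundary (s : R -> R) : Prop :=
  (forall t, 0 <= t -> 0 <= s t) /\
  continuous_on (fun t => 0 <= t) s /\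
  (forall t, 0 < t -> 0 < s t /\ ex_derive s t /\ continuous (Derive s) t).

Definition candidate_pair (alpha theta : R) (T : R -> R -> R) (s : R -> R)
    (A B : R) : Prop :=
  free_boundary s /\
  forall x t, 0 < t -> 0 <= x <= s t -> T x t = profile alpha theta A B s x t.

(* Derivative in space relative to the domain [0, s t]: one-sided at the two
   end points. *)
Definition is_deriv_x (T : R -> R -> R) (s : R -> R) (x t l : R) : Prop :=
  D_in (fun y => T y t) (fun _ => l) (fun y => 0 <= y <= s t) x.

Definition robin_condition (k h alpha theta : R) (T : R -> R -> R) (s : R -> R) : Prop :=
  forall t, 0 < t ->
    exists l, is_deriv_x T s 0 t l /\
      k * l = h / sqrt t * (T 0 t - theta * t ^R (alpha / 2)).

Definition stefan_condition (k gamma alpha : R) (T : R -> R -> R) (s : R -> R) : Prop :=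
  forall t, 0 < t ->
    exists l, is_deriv_x T s (s t) t l /\
      k * l = - gamma * s t ^R alpha * Derive s t.

Definition admissible (k gamma theta h alpha : R) (T : R -> R -> R) (s : R -> R)
    (A B : R) : Prop :=
  candidate_pair alpha theta T s A B /\
  robin_condition k h alpha theta T s /\
  (forall t, 0 < t -> T (s t) t = 0) /\
  stefan_condition k gamma alpha T s /\
  s 0 = 0.

(* (1 / s t) times the integral over 0 <= x <= s t of (T_t - a^2 T_xx)^2, for
   T = profile alpha theta A B s. *)
Definition least_squares_error (alpha theta a A B : R) (s : R -> R) (t : R) : R :=
  alpha ^ 2 / 4 * theta ^ 2 * t ^R (alpha - 2)
    * (A ^ 2 / 3 + A * B / 2 + B ^ 2 / 5)
  + t ^R alpha * theta ^ 2 * (Derive s t ^ 2 / s t ^ 2)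
    * (A ^ 2 / 3 + A * B / 3 + 2 * B ^ 2 / 15)
  + 4 * t ^R alpha * a ^ 4 * theta ^ 2 * (B ^ 2 / s t ^ 4)
  + alpha * theta ^ 2 * t ^R (alpha - 1) * (Derive s t / s t)
    * (A ^ 2 / 6 + A * B / 4 + B ^ 2 / 10)
  - 2 * alpha * a ^ 2 * theta ^ 2 * t ^R (alpha - 1) * (B / s t ^ 2)
    * (A / 2 + B / 3)
  - 4 * a ^ 2 * theta ^ 2 * t ^R alpha * (Derive s t / s t ^ 3) * B
    * (A / 2 + B / 3).

(* The coefficients A, B are determined by T and s, because s is positive on
   (0, oo) and theta <> 0; quantifying over them makes the error a function of
   the pair (T, s). *)
Definition is_solution_P4h (k rho c gamma theta h alpha : R)
    (T : R -> R -> R) (s : R -> R) : Prop :=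
  let a := sqrt_diffusivity k rho c in
  exists A B : R,
    admissible k gamma theta h alpha T s A B /\
    forall (T' : R -> R -> R) (s' : R -> R) (A' B' : R),
      admissible k gamma theta h alpha T' s' A' B' ->
      forall t, 0 < t ->
        least_squares_error alpha theta a A B s t
          <= least_squares_error alpha theta a A' B' s' t.

Definition A4h (alpha Ste nu : R) : R :=
  2 ^R (alpha + 1) * nu ^R (alpha + 2) / Ste.

Definition B4h (alpha Ste Bi nu : R) : R :=
  (2 * Bi * nu - A4h alpha Ste nu * (1 + 2 * Bi * nu)) / (2 * (1 + Bi * nu)).

Definition p_fun (alpha Ste xi : R) : R :=
  2 ^R (2 * alpha + 1) * (alpha ^ 2 + alpha + 4) * xi ^R (2 * alpha + 8)
  + 5 * 2 ^R (2 * alpha + 2) * (1 + alpha) * xi ^R (2 * alpha + 6)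
  + 15 * 2 ^R (2 * alpha + 2) * xi ^R (2 * alpha + 4)
  + 2 ^R alpha * Ste * (2 + 3 * alpha + 3 * alpha ^ 2) * xi ^R (alpha + 6)
  + 5 * 2 ^R (alpha + 1) * Ste * (1 + alpha) * xi ^R (alpha + 4)
  - 15 * 2 ^R (alpha + 2) * Ste * xi ^R (alpha + 2)
  + Ste ^ 2 * (2 + 3 * alpha + 3 * alpha ^ 2) * xi ^ 4
  - 10 * Ste ^ 2 * (1 + alpha) * xi ^ 2
  + 15 * Ste ^ 2.

Definition E_h (alpha theta Ste Bi t xi : R) : R :=
  t ^R (alpha - 2) * theta ^ 2 / (60 * Ste ^ 2 * xi ^ 2 * (1 / Bi + xi) ^ 2)
  * (p_fun alpha Ste xi
     + 1 / Bi *
       (2 ^R (2 * alpha) * (7 * alpha ^ 2 + 7 * alpha + 18) * xi ^R (2 * alpha + 7)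
        + 25 * 2 ^R (2 * alpha + 1) * (alpha + 1) * xi ^R (2 * alpha + 5)
        + 2 ^R alpha * (9 * alpha ^ 2 + 9 * alpha + 6) * Ste * xi ^R (alpha + 5)
        + 15 * 2 ^R (2 * alpha + 2) * xi ^R (2 * alpha + 3)
        - 5 * 2 ^R (alpha + 1) * (alpha + 1) * Ste * xi ^R (alpha + 3)
        - 15 * 2 ^R (alpha + 1) * Ste * xi ^R (alpha + 1))
     + 1 / Bi ^ 2 *
       (4 ^R (alpha + 1) * (2 * alpha ^ 2 + 2 * alpha + 3) * xi ^R (2 * alpha + 6)
        + 5 * 4 ^R (alpha + 1) * (alpha + 1) * xi ^R (2 * alpha + 4)
        + 15 * 4 ^R alpha * xi ^R (2 * alpha + 2))).

(* Main.v *)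
(** Differentiating the profile at the two ends of [0, s t] turns the Stefan
    condition into [s^(alpha+1) s' = (k theta A / gamma) t^(alpha/2)] and the
    Robin condition into a relation between [A], [B] and [s t / sqrt t]. The
    former integrates, using [s 0 = 0], to
    [s^(alpha+2) = (2 k theta A / gamma) t^((alpha+2)/2)], so that [s] is a
    multiple of [sqrt t]. The admissible pairs thus form a one-parameter family
    indexed by [nu > 0], along which the least-squares error is exactly
    [E_h nu]. *)
Require Import Defs.
From Stdlib Require Import Reals Lra.
From Coquelicot Require Import Coquelicot.
Open Scope R_scope.

(** * Real powers of a positive base *)

Lemma Rpower_gt_0 (x y : R) : 0 < x ^R y.
Proof. apply exp_pos. Qed.

Lemma Rpower_plus_pos (x y : R) (p : positive) : 0 < x ->
  x ^R (y + IZR (Zpos p)) = x ^R y * x ^ Pos.to_nat p.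
Proof.
intros hx. rewrite Rpower_plus, <- Rpower_pow by exact hx.
now rewrite INR_IPR.
Qed.

Lemma Rpower_double (x y : R) : x ^R (2 * y) = (x ^R y) ^ 2.
Proof.
replace (2 * y) with (y + y) by ring. rewrite Rpower_plus. ring.
Qed.

Lemma Rpower_inj_base (x y z : R) : z <> 0 -> 0 < x -> 0 < y ->
  x ^R z = y ^R z -> x = y.
Proof.
unfold Rpower. intros hz hx hy e.
apply ln_inv; try assumption.
apply exp_inv in e. now apply Rmult_eq_reg_l in e.
Qed.

(** [Rpower] has the value 1 at base 0, so continuity there cannot make powers of small numbers
    small; this bound does. *)
Lemma Rpower_le_base (x y : R) : 0 < x < 1 -> 1 <= y -> x ^R y <= x.
Proof.
intros [hx hx1] hy. rewrite <- (exp_ln x hx) at 2. unfold Rpower.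
assert (hl : ln x < 0) by (rewrite <- ln_1; now apply ln_increasing).
assert (hle : y * ln x <= ln x) by nra.
destruct hle as [hlt | ->]; [left; now apply exp_increasing | apply Rle_refl].
Qed.

Lemma is_derive_Rpower_comp (f : R -> R) (df y t : R) :
  0 < f t -> is_derive f t df ->
  is_derive (fun u => f u ^R y) t (y * f t ^R (y - 1) * df).
Proof.
intros hf hd. unfold Rpower.
auto_derive.
- split; [now exists df | now split].
- replace (Derive _ t) with df by (symmetry; exact (is_derive_unique f t df hd)).
  replace ((y - 1) * ln (f t)) with (y * ln (f t) + - ln (f t)) by ring.
  rewrite exp_plus, exp_Ropp, exp_ln by exact hf. field. lra.
Qed.

(** * Space derivatives relative to the segment *)

Lemma D_in_unique (f : R -> R) (D : R -> Prop) (x l l' : R) :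
  adhDa (D_x D x) x ->
  D_in f (fun _ => l) D x -> D_in f (fun _ => l') D x -> l = l'.
Proof. intros ha h h'. exact (single_limit _ _ _ _ _ ha h h'). Qed.

(** Uniqueness of a relative derivative needs [x] to be a limit point of the segment. From either
    half, a step of at most [b / 2] towards the other half stays inside. *)
Lemma adherent_segment (b x : R) : 0 < b -> 0 <= x <= b ->
  adhDa (D_x (fun y => 0 <= y <= b) x) x.
Proof.
intros hb hx eps heps. unfold D_x.
pose proof (Rmin_l (b / 2) (eps / 2)) as m1.
pose proof (Rmin_r (b / 2) (eps / 2)) as m2.
assert (m0 : 0 < Rmin (b / 2) (eps / 2)) by (apply Rmin_pos; lra).
set (d := Rmin (b / 2) (eps / 2)) in *.
destruct (Rle_lt_dec x (b / 2)) as [h | h].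
- exists (x + d). split; [lra |].
  unfold R_dist. rewrite Rabs_pos_eq; lra.
- exists (x - d). split; [lra |].
  unfold R_dist. rewrite Rabs_left; lra.
Qed.

(** The profile is a polynomial in space, so its two-sided derivative restricts to the segment,
    where [T] agrees with it; limit-point uniqueness gives the other direction. *)
Lemma is_deriv_x_profile (alpha theta A B : R) (T : R -> R -> R) (s : R -> R)
    (x t l : R) :
  0 < s t -> 0 <= x <= s t ->
  (forall y, 0 <= y <= s t -> T y t = profile alpha theta A B s y t) ->
  is_deriv_x T s x t l <->
  l = t ^R (alpha / 2) * theta * (- (A + 2 * B * (1 - x / s t)) / s t).
Proof.
intros hs hx hT.
set (m := t ^R (alpha / 2) * theta * (- (A + 2 * B * (1 - x / s t)) / s t)).
assert (hm : is_deriv_x T s x t m).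
{ assert (hd : derivable_pt_lim (fun y => profile alpha theta A B s y t) x m).
  { apply is_derive_Reals. unfold profile, m. auto_derive; [trivial | field; lra]. }
  intros eps heps.
  destruct (proj2 (derivable_pt_lim_D_in _ (fun _ => m) x) hd eps heps)
    as [d [hd0 hd1]].
  exists d; split; [exact hd0 |].
  intros y [[hy hne] hdist]. simpl.
  rewrite !hT by assumption.
  apply hd1. split; [split; [exact I | exact hne] | exact hdist]. }
split.
- intros hl. apply (D_in_unique _ _ _ _ _ (adherent_segment _ _ hs hx) hl hm).
- now intros ->.
Qed.

(** * Boundaries proportional to the square root of time *)

Lemma is_derive_scaled_sqrt (s : R -> R) (m t : R) :
  (forall u, 0 < u -> s u = m * sqrt u) -> 0 < t ->
  is_derive s t (m / (2 * sqrt t)).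
Proof.
intros hs ht.
apply is_derive_ext_loc with (fun u => m * sqrt u).
(* The ball of radius [t] about [t] stays in the positive half-line. *)
- exists (mkposreal t ht). intros u hu. symmetry. apply hs.
  apply Rabs_lt_between' in hu. simpl in hu. lra.
- assert (hr := sqrt_lt_R0 t ht). auto_derive; [exact ht | field; lra].
Qed.

Lemma Derive_scaled_sqrt (s : R -> R) (m t : R) :
  (forall u, 0 < u -> s u = m * sqrt u) -> 0 < t ->
  Derive s t = m / (2 * sqrt t).
Proof.
intros hs ht. apply is_derive_unique. now apply is_derive_scaled_sqrt.
Qed.

Lemma free_boundary_scaled_sqrt (m : R) : 0 < m ->
  free_boundary (fun t => m * sqrt t).
Proof.
intros hm. split; [| split].
- intros t ht. apply Rmult_le_pos; [lra | apply sqrt_pos].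
- apply continuous_on_forall. intros t _.
  apply (continuous_scal_r m sqrt), continuous_sqrt.
- intros t ht. assert (hr := sqrt_lt_R0 t ht). split; [| split].
  + now apply Rmult_lt_0_compat.
  + exists (m / (2 * sqrt t)). now apply is_derive_scaled_sqrt.
  + apply continuous_ext_loc with (fun u => m / (2 * sqrt u)).
    * exists (mkposreal t ht). intros u hu. symmetry.
      apply Rabs_lt_between' in hu. simpl in hu.
      apply Derive_scaled_sqrt; [easy | lra].
    * apply (ex_derive_continuous (fun u => m / (2 * sqrt u))).
      auto_derive. repeat split; lra.
Qed.

(** * Integration of the Stefan condition *)

(** If [f t] were nonzero, some [u > 0] would have a value smaller than [Rabs (f t)], while the mean
    value theorem gives [f u = f t]. The value of [f] at 0 never enters, which suits [Rpower]. *)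
Lemma constant_eq_0_of_derive_0 (f : R -> R) :
  (forall t, 0 < t -> is_derive f t 0) ->
  (forall eps, 0 < eps -> exists t, 0 < t /\ Rabs (f t) < eps) ->
  forall t, 0 < t -> f t = 0.
Proof.
intros hd hlim t ht.
destruct (Req_dec (f t) 0) as [| hne]; [assumption | exfalso].
destruct (hlim (Rabs (f t)) (Rabs_pos_lt _ hne)) as [u [hu hlt]].
destruct (MVT_gen f u t (fun _ => 0)) as [v [_ hv]].
- intros x [hx _]. apply hd. apply Rlt_trans with (2 := hx).
  now apply Rmin_glb_lt.
- intros x [hx _]. apply continuity_pt_filterlim.
  apply (ex_derive_continuous f). exists 0. apply hd.
  apply Rlt_le_trans with (2 := hx). now apply Rmin_glb_lt.
- replace (f t) with (f u) in hlt by lra. lra.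
Qed.

(** The difference of the two sides has derivative [(alpha + 2)] times the difference of the two
    sides of the ODE, hence 0, and it becomes arbitrarily small near 0 because [s] is continuous
    with [s 0 = 0]. *)
Lemma power_law_of_ode (s : R -> R) (alpha m : R) :
  0 <= alpha -> free_boundary s -> s 0 = 0 ->
  (forall t, 0 < t -> s t ^R (alpha + 1) * Derive s t = m * t ^R (alpha / 2)) ->
  forall t, 0 < t -> s t ^R (alpha + 2) = 2 * m * t ^R ((alpha + 2) / 2).
Proof.
intros halpha [_ [hcont hs]] hs0 hode t ht.
apply Rminus_diag_uniq. revert t ht.
apply (constant_eq_0_of_derive_0
         (fun t => s t ^R (alpha + 2) - 2 * m * t ^R ((alpha + 2) / 2))).
- intros t ht. destruct (hs t ht) as [hst [hex _]].
  assert (h1 := is_derive_Rpower_comp s (Derive s t) (alpha + 2) t hst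
                  (Derive_correct _ _ hex)).
  assert (h2 := is_derive_Rpower_comp (fun u => u) 1 ((alpha + 2) / 2) t ht
                  (is_derive_id t)).
  apply (is_derive_scal _ _ (2 * m)) in h2.
  assert (h3 := is_derive_minus _ _ _ _ _ h1 h2).
  (* [is_derive] is a [filterdiff], so it remains to identify the computed linear map with the zero
     map. *)
  eapply filterdiff_ext_lin; [exact h3 |]. clear h1 h2 h3.
  intros u. unfold scal, minus, plus, opp; simpl. unfold mult; simpl.
  replace (alpha + 2 - 1) with (alpha + 1) by ring.
  replace ((alpha + 2) / 2 - 1) with (alpha / 2) by field.
  rewrite Rmult_assoc, hode by exact ht. field.
- intros eps heps.
  (* For 0 < t, s t < 1 both powers are bounded by their base. *)
  set (d := Rmin (1 / 2) (eps / 2)).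
  assert (hd : 0 < d) by (apply Rmin_pos; lra).
  assert (hd1 : d <= 1 / 2) by apply Rmin_l.
  assert (hd2 : d <= eps / 2) by apply Rmin_r.
  destruct (proj1 (filterlim_locally _ _) (hcont 0 (Rle_refl 0)) (mkposreal d hd))
    as [e he].
  (* The added 1 keeps the divisor positive even when [m = 0]. *)
  set (M := Rabs (2 * m) + 1).
  assert (hM : 0 < M) by (pose proof (Rabs_pos (2 * m)); unfold M; lra).
  (* The three bounds put [t] within the continuity radius, below 1, and small enough that the
     second term is at most [eps / 2]. *)
  set (t := Rmin (e / 2) (Rmin (1 / 2) (eps / 2 / M))).
  assert (hq : 0 < eps / 2 / M) by (apply Rdiv_lt_0_compat; lra).
  assert (he0 := cond_pos e).
  assert (ht : 0 < t) by (apply Rmin_pos; [lra | apply Rmin_pos; lra]).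
  assert (ht1 : t <= e / 2) by apply Rmin_l.
  assert (ht2 : t <= 1 / 2) by (eapply Rle_trans; [apply Rmin_r | apply Rmin_l]).
  assert (ht3 : t <= eps / 2 / M)
    by (eapply Rle_trans; [apply Rmin_r | apply Rmin_r]).
  exists t; split; [exact ht |].
  destruct (hs t ht) as [hst _].
  assert (hsd : s t < d).
  { assert (hb : ball (s 0) d (s t)).
    { apply he; [| lra]. apply Rabs_lt_between'. simpl. lra. }
    rewrite hs0 in hb. apply Rabs_lt_between' in hb. lra. }
  (* Both exponents are at least 1 since [0 <= alpha]. *)
  assert (b1 : s t ^R (alpha + 2) <= s t) by (apply Rpower_le_base; lra).
  assert (b2 : t ^R ((alpha + 2) / 2) <= t) by (apply Rpower_le_base; lra).
  assert (p1 := Rpower_gt_0 (s t) (alpha + 2)).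
  assert (p2 := Rpower_gt_0 t ((alpha + 2) / 2)).
  assert (b3 : M * t <= eps / 2).
  { replace (eps / 2) with (M * (eps / 2 / M)) by (field; lra).
    apply Rmult_le_compat_l; lra. }
  assert (b4 := Rabs_triang (s t ^R (alpha + 2))
                  (- (2 * m * t ^R ((alpha + 2) / 2)))).
  rewrite Rabs_Ropp, Rabs_mult, (Rabs_pos_eq (s t ^R _)),
    (Rabs_pos_eq (t ^R _)) in b4 by lra.
  unfold Rminus. unfold M in b3. pose proof (Rabs_pos (2 * m)). nra.
Qed.

(** The law at time 1 identifies [m] as [s 1 ^R (alpha + 2)]; both sides then have equal powers, and
    a nonzero power is injective on positive bases. *)
Lemma scaled_sqrt_of_power_law (s : R -> R) (alpha m : R) :
  0 <= alpha -> (forall t, 0 < t -> 0 < s t) ->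
  (forall t, 0 < t -> s t ^R (alpha + 2) = m * t ^R ((alpha + 2) / 2)) ->
  forall t, 0 < t -> s t = s 1 * sqrt t.
Proof.
intros halpha hs hpow t ht.
assert (h1 := hs 1 Rlt_0_1).
apply Rpower_inj_base with (alpha + 2); [lra | auto | |].
- apply Rmult_lt_0_compat; [exact h1 | now apply sqrt_lt_R0].
- rewrite <- Rpower_mult_distr by (try apply sqrt_lt_R0; assumption).
  rewrite hpow, hpow, <- (Rpower_sqrt t), Rpower_mult by lra.
  replace (1 ^R ((alpha + 2) / 2)) with 1
    by (unfold Rpower; now rewrite ln_1, Rmult_0_r, exp_0).
  rewrite Rmult_1_r. f_equal. f_equal. field.
Qed.

(** * Algebra of the coefficients and of the error *)

(** This is the power law at time 1 with [s 1 = 2 * a * nu], cleared of [gamma]; both directions of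
    the classification rest on it. *)
Lemma A4h_stefan_number (k gamma theta alpha a nu : R) :
  0 < k -> 0 < gamma -> 0 < theta -> 0 < a -> 0 < nu ->
  2 * k * theta * A4h alpha (stefan_number k gamma theta alpha a) nu
  = gamma * (2 * a * nu) ^R (alpha + 2).
Proof.
intros hk hgamma htheta ha hnu. unfold A4h, stefan_number.
rewrite <- !Rpower_mult_distr by (try apply Rmult_lt_0_compat; lra).
rewrite !Rpower_plus_pos by lra. simpl.
assert (hp := Rpower_gt_0 a alpha). field. repeat split; lra.
Qed.

(** The right-hand relation is the Robin condition stripped of its common factors. It is linear in
    [B] with nonzero coefficient [2 * (1 + Bi * nu)]. *)
Lemma B4h_iff (alpha Ste Bi nu B : R) : 0 < Bi -> 0 < nu ->
  B = B4h alpha Ste Bi nu <->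
  A4h alpha Ste nu + 2 * B = 2 * Bi * nu * (1 - A4h alpha Ste nu - B).
Proof.
intros hBi hnu. unfold B4h. set (A := A4h alpha Ste nu).
assert (hp : 0 < Bi * nu) by now apply Rmult_lt_0_compat.
split.
- intros ->. field. lra.
- intros e. apply Rmult_eq_reg_r with (2 * (1 + Bi * nu)); [| lra].
  field_simplify; lra.
Qed.

(** Here [s' / s = 1 / (2 t)] and [s ^ 2 = 4 a ^ 2 nu ^ 2 t], so [a] cancels and every term carries
    the same factor [t ^R (alpha - 2)]. *)
Lemma least_squares_error_similarity (alpha theta a Ste Bi nu : R) (s : R -> R)
    (t : R) :
  0 < a -> 0 < Ste -> 0 < Bi -> 0 < nu -> 0 < t ->
  (forall u, 0 < u -> s u = 2 * a * nu * sqrt u) ->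
  least_squares_error alpha theta a (A4h alpha Ste nu) (B4h alpha Ste Bi nu) s t
  = E_h alpha theta Ste Bi t nu.
Proof.
intros ha hSte hBi hnu ht hs.
unfold least_squares_error.
rewrite (Derive_scaled_sqrt _ _ _ hs ht), (hs t ht).
assert (hr := sqrt_lt_R0 t ht).
assert (ht2 : t = sqrt t ^ 2) by (rewrite pow2_sqrt; lra).
assert (e0 : t ^R alpha = t ^R (alpha - 2) * t ^ 2).
{ replace alpha with (alpha - 2 + 2) at 1 by ring. now apply Rpower_plus_pos. }
assert (e1 : t ^R (alpha - 1) = t ^R (alpha - 2) * t).
{ replace (alpha - 1) with (alpha - 2 + 1) by ring.
  rewrite Rpower_plus_pos by exact ht. simpl. ring. }
rewrite e0, e1. clear e0 e1.
unfold E_h, p_fun, B4h, A4h.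
assert (e4 : 4 ^R alpha = (2 ^R alpha) ^ 2).
{ replace 4 with (2 * 2) by ring. rewrite <- Rpower_mult_distr by lra. ring. }
rewrite !Rpower_plus_pos, !Rpower_double, e4 by lra.
cbv [Pos.to_nat Pos.iter_op Nat.add].
clear e4 hs.
(* With the remaining real powers made atoms, the claim is a rational identity in them, [nu] and
   [sqrt t]. *)
generalize (t ^R (alpha - 2)) (2 ^R alpha) (nu ^R alpha). intros P u v.
set (r := sqrt t) in *. rewrite ht2.
assert (hp : 0 < Bi * nu) by now apply Rmult_lt_0_compat.
field. repeat split; lra.
Qed.

(** * Classification of admissible pairs, and minimality *)

Lemma admissible_similarity (k gamma theta h alpha a : R) (T : R -> R -> R)
    (s : R -> R) (A B : R) :
  0 < k -> 0 < gamma -> 0 < theta -> 0 < h -> 0 <= alpha -> 0 < a ->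
  admissible k gamma theta h alpha T s A B ->
  exists nu, 0 < nu /\ (forall t, 0 <= t -> s t = 2 * a * nu * sqrt t) /\
    A = A4h alpha (stefan_number k gamma theta alpha a) nu /\
    B = B4h alpha (stefan_number k gamma theta alpha a) (biot_number k h a) nu.
Proof.
intros hk hgamma htheta hh halpha ha [[hfree hT] [hrobin [_ [hstefan hs0]]]].
assert (hspos : forall t, 0 < t -> 0 < s t) by (intros t ht; now apply hfree).
assert (hode : forall t, 0 < t ->
  s t ^R (alpha + 1) * Derive s t = (k * theta * A / gamma) * t ^R (alpha / 2)).
{ intros t ht. assert (hst := hspos t ht).
  destruct (hstefan t ht) as [l [hl e]].
  apply (is_deriv_x_profile alpha theta A B) in hl;
    [| exact hst | lra | intros y hy; now apply hT].
  rewrite Rpower_plus_pos by exact hst. simpl. subst l.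
  replace (s t / s t) with 1 in e by (field; lra).
  (* This factor restores the Stefan condition up to sign: at the free end the slope is
     [- theta * A * t ^R (alpha / 2) / s t]. *)
  apply Rmult_eq_reg_l with (gamma / s t);
    [| apply Rgt_not_eq, Rdiv_lt_0_compat; lra].
  transitivity (- (- gamma * s t ^R alpha * Derive s t)); [field; lra |].
  rewrite <- e. field. lra. }
assert (hpow := power_law_of_ode s alpha _ halpha hfree hs0 hode).
assert (hsqrt := scaled_sqrt_of_power_law s alpha _ halpha hspos hpow).
assert (hs1 := hspos 1 Rlt_0_1).
(* Forced by [s 1 = 2 * a * nu]. *)
exists (s 1 / (2 * a)).
assert (hnu : 0 < s 1 / (2 * a)) by (apply Rdiv_lt_0_compat; lra).
assert (hs : 2 * a * (s 1 / (2 * a)) = s 1) by (field; lra).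
set (nu := s 1 / (2 * a)) in *.
assert (one_pow : forall y, 1 ^R y = 1)
  by (intros y; unfold Rpower; now rewrite ln_1, Rmult_0_r, exp_0).
assert (hA : A = A4h alpha (stefan_number k gamma theta alpha a) nu).
{ assert (e := A4h_stefan_number k gamma theta alpha a nu hk hgamma htheta ha hnu).
  rewrite hs, (hpow 1 Rlt_0_1), one_pow in e.
  apply Rmult_eq_reg_l with (2 * k * theta);
    [| apply Rgt_not_eq; repeat apply Rmult_lt_0_compat; lra].
  rewrite e. field. lra. }
repeat split.
- exact hnu.
- intros t [ht | <-].
  + rewrite hs. now apply hsqrt.
  + now rewrite sqrt_0, Rmult_0_r.
- exact hA.
- apply B4h_iff; [| exact hnu |].
  { unfold biot_number. apply Rdiv_lt_0_compat; [| exact hk].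
    now apply Rmult_lt_0_compat. }
  rewrite <- hA.
  (* [B] is constant in time, so the Robin condition at time 1 determines it. *)
  destruct (hrobin 1 Rlt_0_1) as [l [hl e]].
  apply (is_deriv_x_profile alpha theta A B) in hl;
    [| exact hs1 | lra | intros y hy; apply hT; lra].
  rewrite hT in e by lra. unfold profile in e. subst l.
  rewrite one_pow, sqrt_1 in e.
  unfold biot_number, nu.
  apply Rmult_eq_reg_l with (k * theta / s 1);
    [| apply Rgt_not_eq, Rdiv_lt_0_compat; [now apply Rmult_lt_0_compat | lra]].
  transitivity (- (k * (1 * theta * (- (A + 2 * B * (1 - 0 / s 1)) / s 1))));
    [field; lra |].
  rewrite e. field. lra.
Qed.

(** The converse: every positive parameter yields a competitor in the minimization. *)
Lemma similarity_admissible (k gamma theta h alpha a nu : R) :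
  0 < k -> 0 < gamma -> 0 < theta -> 0 < h -> 0 < a -> 0 < nu ->
  let A := A4h alpha (stefan_number k gamma theta alpha a) nu in
  let B := B4h alpha (stefan_number k gamma theta alpha a)
             (biot_number k h a) nu in
  let s := fun t => 2 * a * nu * sqrt t in
  admissible k gamma theta h alpha (profile alpha theta A B s) s A B.
Proof.
intros hk hgamma htheta hh ha hnu A B s.
assert (hm : 0 < 2 * a * nu) by (repeat apply Rmult_lt_0_compat; lra).
assert (hspos : forall t, 0 < t -> 0 < s t)
  by (intros t ht; apply Rmult_lt_0_compat; [exact hm | now apply sqrt_lt_R0]).
split; [| split; [| split; [| split]]].
- split; [now apply free_boundary_scaled_sqrt | easy].
- intros t ht. assert (hst := hspos t ht). assert (hr := sqrt_lt_R0 t ht).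
  eexists; split.
  + apply (is_deriv_x_profile alpha theta A B); [exact hst | lra | easy | reflexivity].
  + assert (hB : A + 2 * B = 2 * biot_number k h a * nu * (1 - A - B)).
    { apply B4h_iff; [| exact hnu | reflexivity].
      unfold biot_number. apply Rdiv_lt_0_compat; [| exact hk].
      now apply Rmult_lt_0_compat. }
    unfold profile.
    transitivity (- (k * t ^R (alpha / 2) * theta / s t * (A + 2 * B)));
      [field; lra |].
    rewrite hB. unfold biot_number, s. field. repeat split; lra.
- intros t ht. assert (hst := hspos t ht). unfold profile. field. lra.
- intros t ht. assert (hst := hspos t ht). assert (hr := sqrt_lt_R0 t ht).
  eexists; split.
  + apply (is_deriv_x_profile alpha theta A B); [exact hst | lra | easy | reflexivity].
  + rewrite (Derive_scaled_sqrt s (2 * a * nu) t) by easy.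
    assert (hA := A4h_stefan_number k gamma theta alpha a nu hk hgamma htheta ha hnu).
    fold A in hA.
    (* Isolating [2 * k * theta * A] lets [hA] apply; afterwards [s t ^R alpha] splits into
       [(2 * a * nu) ^R alpha] and [t ^R (alpha / 2)]. *)
    transitivity (- (2 * k * theta * A) * (t ^R (alpha / 2) / (2 * s t)));
      [field; lra |].
    rewrite hA. unfold s.
    rewrite <- (Rpower_mult_distr _ (sqrt t)) by assumption.
    rewrite <- (Rpower_sqrt t) at 2 by exact ht.
    rewrite Rpower_mult. replace (/ 2 * alpha) with (alpha / 2) by field.
    rewrite Rpower_plus_pos by exact hm. simpl. field. lra.
- unfold s. now rewrite sqrt_0, Rmult_0_r.
Qed.

Theorem theorem5p2 (k rho c gamma theta h alpha : R)
  (hk : 0 < k) (hrho : 0 < rho) (hc : 0 < c) (hgamma : 0 < gamma)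
  (htheta : 0 < theta) (hh : 0 < h) (halpha : 0 <= alpha)
  (T4h : R -> R -> R) (s4h : R -> R) :
  let a := sqrt_diffusivity k rho c in
  let Ste := stefan_number k gamma theta alpha a in
  let Bi := biot_number k h a in
  is_solution_P4h k rho c gamma theta h alpha T4h s4h ->
  exists nu4h : R,
    0 < nu4h /\
    (forall t, 0 <= t -> s4h t = 2 * a * nu4h * sqrt t) /\
    (forall x t, 0 < t -> 0 <= x <= s4h t ->
       T4h x t =
         t ^R (alpha / 2) * theta *
           (A4h alpha Ste nu4h * (1 - x / s4h t)
            + B4h alpha Ste Bi nu4h * (1 - x / s4h t) ^ 2)) /\
    (forall t, 0 < t -> forall xi, 0 < xi ->
       E_h alpha theta Ste Bi t nu4h <= E_h alpha theta Ste Bi t xi).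
Proof.
intros a Ste Bi [A [B [hadm hmin]]]. fold a in hmin.
assert (ha : 0 < a).
{ apply sqrt_lt_R0, Rdiv_lt_0_compat; [exact hk | now apply Rmult_lt_0_compat]. }
assert (hSte : 0 < Ste).
{ apply Rdiv_lt_0_compat; apply Rmult_lt_0_compat; try assumption.
  apply Rpower_gt_0. }
assert (hBi : 0 < Bi).
{ apply Rdiv_lt_0_compat; [now apply Rmult_lt_0_compat | exact hk]. }
destruct (admissible_similarity k gamma theta h alpha a _ _ _ _
            hk hgamma htheta hh halpha ha hadm) as [nu [hnu [hs [hA hB]]]].
fold Ste in hA, hB. fold Bi in hB. subst A B.
exists nu. repeat split.
- exact hnu.
- exact hs.
- apply hadm.
- intros t ht xi hxi.
  (* Testing minimality against the similarity pair of parameter [xi] turns it into the inequality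
     for [E_h]. *)
  assert (hle := hmin _ _ _ _ (similarity_admissible k gamma theta h alpha a xi
                    hk hgamma htheta hh ha hxi) t ht).
  fold Ste in hle. fold Bi in hle.
  rewrite !least_squares_error_similarity with (nu := nu) in hle
    by (try assumption; intros u hu; apply hs; lra).
  rewrite least_squares_error_similarity with (nu := xi) in hle by easy.
  exact hle.
Qed.
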